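(* Let $(X,d)$ be a finite metric space. Then $$\wp(X,d)=\min\{p\ge 0 : \det(D_p)=0 \ \text{ or }\ \langle D_p^{-1}\mathbf{1},\mathbf{1}\rangle=0\},$$ where $D_p$ is an associated $p$-distance matrix for $(X,d)$.
   Context: For $p\ge 0$, a metric space $(X,d)$ has $p$-negative type if and only if for all natural numbers $k\ge 2$, all finite subsets $\{x_1,\dots,x_k\}\subset X$ and all choices of real numbers $\alpha_1,\dots,\alpha_k$ with $\alpha_1+\cdots+\alpha_k=0$ one has $\sum_{1\le i,j\le k} d(x_i,x_j)^p\alpha_i\alpha_j\le 0$. The supremal $p$-negative type of $(X,d)$ is $\wp(X,d)=\sup\{p : (X,d)\text{ has }p\text{-negative type}\}$, which may be $\infty$. For a finite metric space $(X,d)$ with a labelling $x_1,\dots,x_n$ of its elements and $p\ge 0$, the associated $p$-distance matrix is $D_p=[d(x_i,x_j)^p]_{i,j}$ (the choice of labelling is unimportant); for $p=0$ the diagonal entries are taken to be $0$. $\mathbf{1}\in\mathbb{R}^n$ is the vector whose entries are all $1$, and $\langle\cdot,\cdot\rangle$ is the standard inner product on $\mathbb{R}^n$. The condition $\langle D_p^{-1}\mathbf{1},\mathbf{1}\rangle=0$ is understood for those $p$ for which $D_p^{-1}$ exists, and the minimum of the empty set is read as $\infty$.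
   Formalization: The finite metric space is assumed to have at least two points; for a one-point space D_p = (0), so the minimum is 0 while the supremal negative type is infinite, and the empty space fails likewise. *)

(* Defs.v *)
From HB Require Import structures.
From mathcomp Require Import all_boot all_order all_algebra.
From mathcomp Require Import all_classical all_reals all_analysis.

Set Implicit Arguments.
Unset Strict Implicit.
Unset Printing Implicit Defensive.
Import Order.TTheory GRing.Theory Num.Theory.
Local Open Scope classical_set_scope.
Local Open Scope ring_scope.

(* d(x, y)^p, with the convention d(x, x)^p = 0 also when p = 0
   (whereas powR has 0 `^ 0 = 1). *)
Definition distpow (R : realType) (X : metricType R) (p : R) (x y : X) : R :=
  if x == y then 0 else mdist x y `^ p.

Definition negative_type (R : realType) (X : metricType R) (p : R) : Prop :=
  forall (k : nat) (x : 'I_k -> X) (a : 'I_k -> R),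
    (2 <= k)%N -> injective x -> \sum_(i < k) a i = 0 ->
    \sum_(i < k) \sum_(j < k) distpow p (x i) (x j) * a i * a j <= 0.

Definition supremal_negative_type (R : realType) (X : metricType R) : \bar R :=
  ereal_sup [set p%:E | p in [set p : R | 0 <= p /\ negative_type X p]].

Definition distmx (R : realType) (X : metricType R) (n : nat) (x : 'I_n -> X)
    (p : R) : 'M[R]_n :=
  \matrix_(i, j) distpow p (x i) (x j).

Definition dotcv (R : realType) (n : nat) (u v : 'cV[R]_n) : R :=
  \sum_(i < n) u i 0 * v i 0.

(* m is the minimum of S, which must be attained unless S is empty, in which
   case m = +oo. *)
Definition is_min (R : realType) (S : set R) (m : \bar R) : Prop :=
  (S = set0 /\ m = +oo%E) \/
  (exists p : R, [/\ S p, (forall q, S q -> p <= q) & m = p%:E]).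

(* Main.v *)
(** Write [qf T a] for the quadratic form of the matrix [T = D_p]; negative type
    means [qf T a <= 0] on the hyperplane [\sum a = 0].

    Negative type at [p] implies strict negative type at every [q < p]. Put
    [al = q / p]. When [T] is strictly negative on the hyperplane, [1 - T / c]
    (entrywise, with [1] the all-ones matrix) is positive semidefinite for large
    [c] by Finsler's lemma. The binomial series
    [1 - (1 - s) ^ al = \sum_(k >= 1) c_k s ^ k] has nonnegative coefficients,
    so Schur's product theorem makes [(T / c) ^ al] negative on the hyperplane.
    The tail of the series makes it strictly so with a margin independent of
    [c], hence an arbitrary [T] can be reached as the limit of [T + e (1 - I)].

    Strict negative type at [p] forces [D_p] to be invertible with
    [<D_p^-1 1, 1> != 0]. Conversely, if [D_p] is invertible and
    [<D_p^-1 1, 1> != 0], negative type at [p] is strict with a positive margin,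
    and so persists slightly beyond [p] by continuity. *)

Require Import Defs.
From mathcomp Require Import all_boot all_order all_algebra.
From mathcomp Require Import all_classical all_reals all_analysis.
From mathcomp Require Import ring lra.
Import Order.TTheory GRing.Theory Num.Theory.
Import numFieldNormedType.Exports.
Local Open Scope classical_set_scope.
Local Open Scope ring_scope.

Set Implicit Arguments.
Unset Strict Implicit.
Unset Printing Implicit Defensive.

(** * Quadratic forms and Schur's product theorem *)

Section QuadraticForms.
Variables (R : realFieldType) (I : finType).
Implicit Types (K L : I -> I -> R) (a b : I -> R).

Definition bf K a b : R := \sum_i \sum_j K i j * a i * b j.

Definition qf K a : R := bf K a a.

Definition sqnorm a : R := \sum_i a i ^+ 2.

Definition symf K := forall i j, K i j = K j i.

Definition psd K := symf K /\ forall a, 0 <= qf K a.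

Lemma eq_qf K L a : (forall i j, K i j = L i j) -> qf K a = qf L a.
Proof. by move=> KL; do 2! apply: eq_bigr => ? _; rewrite KL. Qed.

Lemma qfDl K L a : qf (fun i j => K i j + L i j) a = qf K a + qf L a.
Proof.
rewrite -big_split; apply: eq_bigr => i _ /=.
by rewrite -big_split; apply: eq_bigr => j _ /=; rewrite !mulrDl.
Qed.

Lemma qfZl c K a : qf (fun i j => c * K i j) a = c * qf K a.
Proof.
rewrite /qf /bf mulr_sumr; apply: eq_bigr => i _.
by rewrite mulr_sumr; apply: eq_bigr => j _; rewrite !mulrA.
Qed.

Lemma qfNl K a : qf (fun i j => - K i j) a = - qf K a.
Proof.
by rewrite -mulN1r -qfZl; apply: eq_qf => i j; rewrite mulN1r.
Qed.

Lemma qfBl K L a : qf (fun i j => K i j - L i j) a = qf K a - qf L a.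
Proof. by rewrite -qfNl -qfDl. Qed.

Lemma qf_rank1 (v : I -> R) a :
  qf (fun i j => v i * v j) a = (\sum_i v i * a i) ^+ 2.
Proof.
rewrite expr2 mulr_suml; apply: eq_bigr => i _; rewrite mulr_sumr.
by apply: eq_bigr => j _; ring.
Qed.

Lemma qf1 a : qf (fun _ _ => 1) a = (\sum_i a i) ^+ 2.
Proof.
rewrite -(eq_bigr _ (fun i _ => mul1r (a i))) -qf_rank1.
by apply: eq_qf => i j; rewrite mulr1.
Qed.

Lemma qf_id a : qf (fun i j => (i == j)%:R) a = sqnorm a.
Proof.
apply: eq_bigr => i _; rewrite (bigD1 i)//= eqxx mul1r big1 ?addr0 ?expr2//.
by move=> j; rewrite eq_sym => /negPf ->; rewrite !mul0r.
Qed.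

Lemma bfC K a b : symf K -> bf K a b = bf K b a.
Proof.
move=> sK; rewrite /bf exchange_big; do 2! apply: eq_bigr => ? _ /=.
by rewrite sK mulrAC.
Qed.

Lemma qf_line K a b t : symf K ->
  qf K (fun i => a i + t * b i) = qf K a + t * bf K a b *+ 2 + t ^+ 2 * qf K b.
Proof.
move=> sK.
have -> : t * bf K a b *+ 2 = t * bf K a b + t * bf K b a.
  by rewrite mulr2n (bfC b a sK).
rewrite /qf /bf !mulr_sumr -!big_split; apply: eq_bigr => i _ /=.
by rewrite !mulr_sumr -!big_split; apply: eq_bigr => j _ /=; ring.
Qed.

Lemma bf_delta K p b : bf K (fun i => (i == p)%:R) b = \sum_j K p j * b j.
Proof.
rewrite /bf (bigD1 p)//= [X in _ + X]big1 ?addr0.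
  by apply: eq_bigr => j _; rewrite eqxx mulr1.
by move=> i /negPf ip; apply: big1 => j _; rewrite ip mulr0 mul0r.
Qed.

Lemma qf_delta K p : qf K (fun i => (i == p)%:R) = K p p.
Proof.
rewrite /qf bf_delta (bigD1 p)//= eqxx mulr1 big1 ?addr0// => j /negPf ->.
by rewrite mulr0.
Qed.

Lemma discriminant_le (A B C : R) : 0 <= A -> 0 <= C ->
  (forall t, 0 <= A + t * B *+ 2 + t ^+ 2 * C) -> B ^+ 2 <= A * C.
Proof.
move=> A0; rewrite le_eqVlt => /predU1P[<-|C0] h.
  rewrite mulr0; have [->|B0] := eqVneq B 0; first by rewrite expr0n.
  (* The polynomial is affine here; at this point its value is [- A - 2]. *)
  have := h (- (A + 1) / B).
  by rewrite divfK// mulr0 addr0; lra.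
have := h (- B / C); rewrite mulNr sqrrN mulNr mulNrn.
have -> : A - B / C * B *+ 2 + (B / C) ^+ 2 * C = A - B ^+ 2 / C.
  by field; rewrite gt_eqF.
by rewrite subr_ge0 ler_pdivrMr.
Qed.

(** Cauchy-Schwarz: [qf K] along the line [a + t b] is a nonnegative quadratic in [t]. *)
Lemma psd_bf_sqr K a b : psd K -> bf K a b ^+ 2 <= qf K a * qf K b.
Proof.
by case=> sK pK; apply: discriminant_le => // t; rewrite -qf_line.
Qed.

Lemma psd_diag_ge0 K i : psd K -> 0 <= K i i.
Proof. by case=> _; rewrite -qf_delta; apply. Qed.

Lemma psd_eq0 K p j : psd K -> K p p = 0 -> K p j = 0.
Proof.
move=> pK Kp; have := psd_bf_sqr (fun i => (i == p)%:R)
  (fun i => (i == j)%:R) pK.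
rewrite !qf_delta Kp mul0r bf_delta (bigD1 j)//= eqxx mulr1 big1 ?addr0.
  by rewrite exprn_even_le0//= => /eqP.
by move=> i /negPf ->; rewrite mulr0.
Qed.

(** The Schur complement at [a] is the value of [qf K] at [a] shifted along the [p]-th unit vector
    to its minimum. *)
Lemma psd_elim K p : psd K -> K p p != 0 ->
  psd (fun i j => K i j - (K p p)^-1 * (K p i * K p j)).
Proof.
move=> [sK pK] Kp; split=> [i j|a]; first by rewrite sK [K p i * _]mulrC.
rewrite qfBl qfZl qf_rank1.
set s := \sum_i _; have := pK (fun i => a i + - (s / K p p) * (i == p)%:R).
rewrite qf_line// bfC// bf_delta qf_delta -/s.
suff -> : qf K a + - (s / K p p) * s *+ 2 + (- (s / K p p)) ^+ 2 * K p p =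
  qf K a - (K p p)^-1 * s ^+ 2 by [].
by field.
Qed.

(** Induction on the number of nonzero diagonal entries of [K]: eliminating a pivot [p] splits off a
    rank-one matrix, whose entrywise product with [L] is [L] evaluated on a rescaled vector. Without
    a pivot, [K] vanishes. *)
Lemma psd_schur K L : psd K -> psd L -> psd (fun i j => K i j * L i j).
Proof.
move=> + pL; have [m] := ubnP #|[pred i | K i i != 0]|.
elim: m K => // m IH K leKm pK.
have [/existsP[p Kp]|] := boolP [exists p, K p p != 0]; last first.
  rewrite negb_exists => /forallP K0; split=> [i j|a].
    by rewrite (proj1 pK) (proj1 pL).
  rewrite /qf /bf big1// => i _; rewrite big1// => j _.
  by rewrite (psd_eq0 _ pK) ?mul0r//; apply/eqP; move: (K0 i); rewrite negbK.
have pK' := psd_elim pK Kp.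
set K' := fun i j => _ in pK'.
have K'p i : K' i p = 0.
  by rewrite /K' (proj1 pK p i) mulrC mulfK ?subrr.
have [|_ pKL] := IH K' _ pK'.
  rewrite -ltnS; apply: leq_trans leKm; rewrite ltnS; apply: proper_card.
  apply/properP; split; last by exists p; rewrite !inE ?K'p ?eqxx.
  apply/fintype.subsetP => i; rewrite !inE; apply: contra => /eqP Ki.
  by rewrite /K' Ki (proj1 pK p i) (psd_eq0 p pK Ki) mul0r mulr0 subrr.
split=> [i j|a]; first by rewrite (proj1 pK) (proj1 pL).
have -> : qf (fun i j => K i j * L i j) a =
    qf (fun i j => K' i j * L i j) a + (K p p)^-1 * qf L (fun i => K p i * a i).
  rewrite -(qfZl _ L) /qf /bf -big_split; apply: eq_bigr => i _ /=.
  by rewrite -big_split; apply: eq_bigr => j _ /=; rewrite /K'; ring.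
rewrite addr_ge0// mulr_ge0 ?invr_ge0 ?psd_diag_ge0//.
by case: pL.
Qed.

Lemma psd_exp K k : psd K -> psd (fun i j => K i j ^+ k).
Proof.
move=> pK; elim: k => [|k IH].
  by split=> [//|a]; rewrite qf1 sqr_ge0.
have := psd_schur pK IH; congr psd.
by apply/funext => i; apply/funext => j; rewrite exprS.
Qed.

Lemma sqnorm_ge0 a : 0 <= sqnorm a.
Proof. by apply: sumr_ge0 => i _; exact: sqr_ge0. Qed.

Lemma qf_bound K a (r : R) : (forall i j, `|K i j| <= r) ->
  `|qf K a| <= r * #|I|%:R * sqnorm a.
Proof.
move=> Kr; have -> : r * #|I|%:R * sqnorm a =
    \sum_i \sum_j r * ((a i ^+ 2 + a j ^+ 2) / 2).
  under eq_bigr do rewrite -mulr_sumr -mulr_suml big_split/= sumr_const.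
  rewrite -mulr_sumr -mulr_suml big_split/= sumr_const -/(sqnorm a).
  rewrite -mulrA; congr (_ * _).
  rewrite sumrMnl -/(sqnorm a) -[sqnorm a *+ _]mulr_natl -mulrDl.
  change (#|I|%:R * sqnorm a = (#|I|%:R + #|I|%:R) * sqnorm a / 2).
  by move: #|I|%:R => z; field.
apply: le_trans (ler_norm_sum _ _ _) _; apply: ler_sum => i _.
apply: le_trans (ler_norm_sum _ _ _) _; apply: ler_sum => j _.
rewrite -mulrA normrM ler_pM// normrM.
rewrite ler_pdivlMr// -(real_normK (num_real (a i))).
rewrite -(real_normK (num_real (a j))).
have := sqr_ge0 (`|a i| - `|a j|); nra.
Qed.

End QuadraticForms.

(** * The binomial series of [y `^ al] around [y = 1] *)

Section BinomialSeries.
Variables (R : realType) (al : R).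
Hypotheses (al0 : 0 < al) (al1 : al < 1).

(* [binq N] is the value at [s = 1] of [1 - \sum_(1 <= k <= N) c_k s ^ k], where
   [c_(k+1) = binc k] and [1 - (1 - s) ^ al = \sum_(k >= 1) c_k s ^ k]; [binp N]
   is the same partial sum in the variable [y = 1 - s]. *)
Definition binq N : R := \prod_(i < N) (1 - al / i.+1%:R).

Definition binc N : R := al * binq N / N.+1%:R.

Fixpoint binp N : {poly R} :=
  if N is N'.+1 then binp N' - binc N' *: (1 - 'X) ^+ N'.+1 else 1.

Lemma binqS N : binq N.+1 = binq N - binc N.
Proof. by rewrite /binq big_ord_recr /= /binc /binq; ring. Qed.

Lemma binpS N : binp N.+1 = binp N - binc N *: (1 - 'X) ^+ N.+1.
Proof. by []. Qed.

Lemma binq_factor_itv N : 0 <= 1 - al / N.+1%:R <= 1.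
Proof.
rewrite subr_ge0 ler_pdivrMr// mul1r (le_trans (ltW al1)) ?ler1n//=.
by rewrite gerBl divr_ge0 ?ltW.
Qed.

Lemma binq_itv N : 0 <= binq N <= 1.
Proof.
elim: N => [|N /andP[q0 q1]]; first by rewrite /binq big_ord0 ler01 lexx.
have /andP[f0 f1] := binq_factor_itv N.
by rewrite /binq big_ord_recr mulr_ge0//= mulr_ile1.
Qed.

Lemma binc_ge0 N : 0 <= binc N.
Proof.
by have /andP[q0 _] := binq_itv N; rewrite divr_ge0// mulr_ge0// ltW.
Qed.

Lemma horner_binpS N y :
  (binp N.+1).[y] = (binp N).[y] - binc N * (1 - y) ^+ N.+1.
Proof.
rewrite /= hornerD hornerN hornerZ horner_exp hornerD hornerN.
by rewrite hornerX hornerC.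
Qed.

Lemma binp0 N : (binp N).[0] = binq N.
Proof.
elim: N => [|N IH]; first by rewrite /binq big_ord0 hornerC.
by rewrite horner_binpS binqS IH subr0 expr1n mulr1.
Qed.

Lemma binp1 N : (binp N).[1] = 1.
Proof.
elim: N => [|N IH]; first by rewrite hornerC.
by rewrite horner_binpS IH subrr expr0n mulr0 subr0.
Qed.

Lemma binp_homo N y : 0 <= y <= 1 -> (binp N).[0] <= (binp N).[y].
Proof.
move=> /andP[y0 y1]; elim: N => [|N IH].
  by rewrite !hornerC.
rewrite !horner_binpS subr0 expr1n lerB// ler_wpM2l ?binc_ge0//.
by rewrite exprn_ile1// ?subr_ge0// gerBl.
Qed.

(* The function [y `^ al] satisfies this equation with right-hand side 0. *)
Lemma binp_ode N y :
  al * (binp N).[y] - y * (binp N)^`().[y] = al * binq N * (1 - y) ^+ N.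
Proof.
elim: N => [|N IH].
  rewrite /binq big_ord0 derivC !hornerC; ring.
have E : N.+1%:R * binc N = al * binq N by rewrite /binc; field.
have D : ((1 - 'X : {poly R}) ^+ N.+1)^`().[y] = - (N.+1%:R * (1 - y) ^+ N).
  rewrite deriv_exp derivB derivC derivX sub0r /=.
  rewrite hornerMn hornerM horner_exp !(hornerN, hornerD, hornerC, hornerX).
  by rewrite mulN1r mulNrn mulr_natl.
rewrite horner_binpS binqS binpS derivB derivZ hornerD hornerN hornerZ D.
have -> : al * (binq N - binc N) = (N.+1%:R - al) * binc N.
  by rewrite mulrBr mulrBl E.
move: IH; rewrite -E => IH.
have -> : al * ((binp N).[y] - binc N * (1 - y) ^+ N.+1) -
  y * ((binp N)^`().[y] - binc N * - (N.+1%:R * (1 - y) ^+ N)) =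
  al * (binp N).[y] - y * (binp N)^`().[y] -
  al * binc N * (1 - y) ^+ N.+1 - y * binc N * (N.+1%:R * (1 - y) ^+ N) by ring.
rewrite IH exprS; ring.
Qed.

(** By [binp_ode], the quotient of [binp N] by z^al has an explicit derivative, nonpositive on ]0,
    1]; the mean value theorem on [y, 1] gives both bounds. *)
Lemma binp_powR_bounds N (y : R) : 0 < y <= 1 ->
  0 <= (binp N).[y] - y `^ al <= y^-1 * (1 - y) ^+ N.
Proof.
move=> /andP[y0]; rewrite le_eqVlt => /predU1P[->|y1].
  by rewrite binp1 powR1 subrr lexx /= mulr_ge0 ?invr_ge0 ?exprn_ge0.
pose f z := (binp N).[z] * z `^ (- al).
pose df z := - (al * binq N * (1 - z) ^+ N * z `^ (- al - 1)).
have fder (z : R) : 0 < z -> is_derive z 1 f (df z).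
  move=> z0; have h1 := is_derive_poly (binp N) z.
  have h2 := is_derive1_powR (- al) z0.
  apply: is_derive_eq (is_deriveM h1 h2) _.
  rewrite /df -binp_ode /GRing.scale /=.
  have -> : z `^ (- al) = z * z `^ (- al - 1).
    rewrite -{2}(powRr1 (ltW z0)) -powRD.
      by rewrite addrC subrK.
    by rewrite (gt_eqF z0); exact: implybT.
  ring.
have [||c] := @MVT _ f df y 1 y1.
- by move=> z; rewrite in_itv/= => /andP[yz _]; apply/fder/(lt_trans y0).
- apply: continuous_in_subspaceT => z; rewrite inE/= in_itv/= => /andP[yz _].
  have := fder z (lt_le_trans y0 yz) => -[dfz _].
  exact/differentiable_continuous/derivable1_diffP.
rewrite in_itv/= => /andP[yc c1]; rewrite /f /df binp1 powR1 mulr1 => E.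
have {}E : (binp N).[y] - y `^ al =
    y `^ al * (al * binq N * (1 - c) ^+ N * c `^ (- al - 1) * (1 - y)).
  have ya : y `^ al != 0 by rewrite gt_eqF// powR_gt0.
  move: E; rewrite powRN => E; apply: (mulfI (invr_neq0 ya)).
  rewrite mulKf// mulrBr mulVf//; lra.
have [q0 q1] := andP (binq_itv N).
have c0 : 0 < c by apply: lt_trans yc.
rewrite E; apply/andP; split.
  rewrite !mulr_ge0 ?powR_ge0 ?exprn_ge0 ?subr_ge0 ?(ltW al0)//; exact: ltW.
have -> : y^-1 = y `^ al * y `^ (- al - 1).
  rewrite -powRD; last by rewrite (gt_eqF y0); exact: implybT.
  by rewrite addrA subrr sub0r powR_inv1// ltW.
rewrite -[leRHS]mulrA ler_wpM2l ?powR_ge0//.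
have cy : c `^ (- al - 1) <= y `^ (- al - 1).
  rewrite -opprD !powRN lef_pV2 ?posrE ?powR_gt0//.
  by rewrite ge0_ler_powR ?nnegrE ?(ltW y0) ?(ltW c0) ?(ltW yc) ?addr_ge0 ?(ltW
    al0).
have cyN : (1 - c) ^+ N <= (1 - y) ^+ N.
  by rewrite lerXn2r ?nnegrE ?subr_ge0 ?(ltW c1) ?(ltW y1)// lerD2l lerN2 ltW.
have c1' : 0 <= 1 - c by rewrite subr_ge0 ltW.
have y1' : 0 <= 1 - y by rewrite subr_ge0 ltW.
have aq0 : 0 <= al * binq N by rewrite mulr_ge0// ltW.
rewrite [leRHS]mulrC -[leRHS]mulr1 ler_pM ?mulr_ge0 ?powR_ge0 ?exprn_ge0 ?(ltW
  al0)//.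
  rewrite ler_pM ?mulr_ge0 ?powR_ge0 ?exprn_ge0 ?(ltW al0)//.
  by rewrite -[leRHS]mul1r ler_pM ?exprn_ge0 ?(ltW al0)// mulr_ile1 ?(ltW al0)
    ?(ltW al1).
by rewrite gerBl ltW.
Qed.

Lemma cvg_binp (y : R) : 0 < y <= 1 -> (binp N).[y] @[N --> \oo] --> y `^ al.
Proof.
move=> y01; have /andP[y0 y1] := y01.
rewrite -[X in _ --> X]add0r.
under eq_cvg do rewrite -[(binp _).[y]](subrK (y `^ al)).
apply: cvgD; last exact: cvg_cst.
apply: (@squeeze_cvgr _ _ _ _ (cst 0) (fun N => y^-1 * (1 - y) ^+ N)).
- by apply: nearW => N; exact: binp_powR_bounds.
- exact: cvg_cst.
- rewrite -(mulr0 y^-1); apply: cvgM; first exact: cvg_cst.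
  by apply: cvg_expr; rewrite ger0_norm ?subr_ge0// gtrBl.
Qed.

(** The error bound of [binp_powR_bounds] blows up at 0. Instead, [binq N] is the value at 0, hence
    at most [(binp N).[y]], whose limit y^al is small for small [y]. *)
Lemma cvg_binq : binq N @[N --> \oo] --> (0 : R).
Proof.
apply/cvgrPdist_le => e e0.
pose y := Num.min 1 ((e / 2) `^ al^-1).
have y0 : 0 < y by rewrite lt_min ltr01 powR_gt0 ?divr_gt0.
have y1 : y <= 1 by rewrite ge_min lexx.
have ye : y `^ al <= e / 2.
  rewrite -[leRHS]powRr1 ?divr_ge0 ?(ltW e0)//.
  rewrite -[X in _ <= _ `^ X](mulVf (lt0r_neq0 al0)) powRrM ge0_ler_powR//.
  - by rewrite ltW.
  - by rewrite nnegrE ltW.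
  - by rewrite nnegrE powR_ge0.
  - by rewrite /y ge_min lexx orbT.
have := @cvg_binp y; rewrite y0 y1 => /(_ isT)/cvgrPdist_le/(_ (e / 2)).
rewrite divr_gt0// => /(_ isT); apply: filterS => N.
have /andP[q0 _] := binq_itv N.
move=> h; rewrite sub0r normrN ger0_norm//; move: h; rewrite distrC =>
  /ler_normlW.
have := @binp_homo N y; rewrite binp0 (ltW y0) y1 => /(_ isT); lra.
Qed.

(** The right-hand side is nondecreasing in [N], by the tangent bound y^al <= 1 - al (1 - y) at y =
    (N+1)/(N+2), which is the first partial sum in [binp_powR_bounds]. *)
Lemma binq_lb N : 1 - al <= binq N.+1 * N.+1%:R `^ al.
Proof.
elim: N => [|N IH].
  by rewrite /binq big_ord1 powR1 mulr1 divr1.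
apply: (le_trans IH); rewrite [binq N.+2]big_ord_recr/= -/(binq N.+1).
have /andP[q0 _] := binq_itv N.+1.
rewrite -mulrA ler_wpM2l//.
pose y : R := N.+1%:R / N.+2%:R.
have y01 : 0 < y <= 1.
  by rewrite divr_gt0//= ler_pdivrMr// mul1r ler_nat.
have -> : N.+1%:R = y * N.+2%:R :> R by rewrite divfK.
rewrite powRM ?ler0n//; last by case/andP: y01 => /ltW.
rewrite ler_wpM2r ?powR_ge0//.
have /andP[+ _] := binp_powR_bounds 1 y01.
rewrite subr_ge0 horner_binpS hornerC expr1 /binc /binq big_ord0 mulr1 divr1.
suff -> : 1 - y = N.+2%:R^-1 by [].
by rewrite /y; field.
Qed.

End BinomialSeries.

(** * Conditionally negative matrices *)

(** Makes [(1 - x) ^+ k] small once [k x] is large; the induction uses (1 - x)(1 + (k+1) x) <= 1 + k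
    x. *)
Lemma bernoulli (R : realFieldType) (k : nat) (x : R) : 0 <= x -> x <= 1 ->
  (1 - x) ^+ k * (1 + k%:R * x) <= 1.
Proof.
move=> x0 x1; elim: k => [|k]; first by rewrite expr0 mul0r addr0 mulr1.
apply: le_trans; rewrite exprSr -mulrA ler_wpM2l ?exprn_ge0 ?subr_ge0//.
have := mulr_ge0 (ler0n R k.+1) (sqr_ge0 x); rewrite -natr1; nra.
Qed.

Section ConditionallyNegative.
Variables (R : realType) (I : finType).
Implicit Types (T : I -> I -> R) (a : I -> R).

(* Negative on the hyperplane [\sum a = 0] with margin [e]: negative type is
   [cneg 0], and [cneg e] with [0 < e] is strict negative type. *)
Definition cneg (e : R) T :=
  forall a, \sum_i a i = 0 -> qf T a <= - e * sqnorm a.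

Lemma cvg_qf (U : Type) (F : set_system U) (FF : Filter F)
    (K : U -> I -> I -> R) T a :
  (forall i j, K u i j @[u --> F] --> T i j) ->
  qf (K u) a @[u --> F] --> qf T a.
Proof.
move=> KT; apply: cvg_big => [|i _]; first exact: add_continuous.
apply: cvg_big => [|j _]; first exact: add_continuous.
by apply: cvgM; [apply: cvgM|]; [exact: KT|exact: cvg_cst|exact: cvg_cst].
Qed.

Lemma cneg_closed (U : Type) (F : set_system U) (FF : ProperFilter F)
    (K : U -> I -> I -> R) T e :
  (forall i j, K u i j @[u --> F] --> T i j) ->
  (\forall u \near F, cneg e (K u)) -> cneg e T.
Proof.
move=> KT cK a a0; apply: cvgr_to_le (cvg_qf (a := a) FF KT) _.
by apply: filterS cK => u; apply.
Qed.

(** Split [a] into its mean [m] and a zero-sum part [u]. Completing the square bounds the cross term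
    by [e * sqnorm u], which the margin absorbs, plus a multiple of [m ^+ 2]. *)
Lemma finsler T e : symf T -> 0 < e -> cneg e T ->
  exists c0, forall a, qf T a <= c0 * (\sum_i a i) ^+ 2.
Proof.
move=> sT e0 cT.
pose r i := \sum_j T i j.
pose d := \sum_i r i ^+ 2 / e + qf T (fun=> 1).
exists (#|I|%:R ^- 2 * d) => a; set s := \sum_i a i.
have [I0|I0] := posnP #|I|.
  have E (F : I -> R) : \sum_i F i = 0.
    by apply: big1 => i; have := fintype0 i I0.
  by rewrite /s /qf /bf !E expr0n mulr0.
have n0 : (#|I|%:R : R) != 0 by rewrite pnatr_eq0 -lt0n.
pose m := s / #|I|%:R; pose u i := a i - m.
have u0 : \sum_i u i = 0.
  by rewrite big_split/= sumrN sumr_const -[m *+ _]mulr_natr divfK// subrr.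
have -> : qf T a = qf T (fun i => u i + m * 1).
  by congr qf; apply/funext => i; rewrite mulr1 subrK.
rewrite qf_line//.
have -> : #|I|%:R ^- 2 * d * s ^+ 2 = m ^+ 2 * d by rewrite /m; field.
have -> : bf T u (fun=> 1) = \sum_i u i * r i.
  apply: eq_bigr => i _; rewrite mulr_sumr; apply: eq_bigr => j _.
  by rewrite mulr1 mulrC.
have h : m * (\sum_i u i * r i) *+ 2 <= e * sqnorm u + m ^+ 2 * \sum_i r i ^+ 2
  / e.
  rewrite /sqnorm !mulr_sumr -sumrMnl -big_split; apply: ler_sum => i _ /=.
  rewrite -subr_ge0.
  have -> : e * u i ^+ 2 + m ^+ 2 * (r i ^+ 2 / e) - m * (u i * r i) *+ 2 =
    e * (u i - m * r i / e) ^+ 2 by field; rewrite gt_eqF.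
  by rewrite mulr_ge0 ?sqr_ge0 ?ltW.
have := cT u u0; rewrite /d mulrDr; lra.
Qed.

(* The constant in [cneg] depends neither on [e] nor on the size of [T]: this
   makes the strict inequality survive the limit [e --> 0]. *)
Lemma cneg_powR T (al tau e : R) : 0 < al < 1 -> 0 < tau -> 0 < e ->
  symf T -> (forall i, T i i = 0) -> (forall i j, i != j -> tau <= T i j) ->
  cneg e T ->
  cneg ((1 - al) / 2 * (4 * #|I|%:R / tau) `^ (- al)) (fun i j => T i j `^ al).
Proof.
move=> /andP[al0 al1] tau0 e0 sT T0 Ttau cT a a0.
have [I0|I0] := posnP #|I|.
  have E (F : I -> R) : \sum_i F i = 0.
    by apply: big1 => i; have := fintype0 i I0.
  by rewrite /sqnorm /qf /bf !E mulr0.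
set n : R := #|I|%:R.
have n1 : 1 <= n by rewrite ler1n.
have [c0 Hc0] := finsler sT e0 cT.
(* [c0] makes [1 - T / c] semidefinite, [tau] makes [c] positive with [tau / c <= 1], and the sum
   bounds every entry of [T]. *)
pose c := Num.max c0 (Num.max tau (\sum_i \sum_j `|T i j|)).
have cc0 : c0 <= c by rewrite le_max lexx.
have ctau : tau <= c by rewrite !le_max lexx orbT.
have c_gt0 : 0 < c by apply: lt_le_trans ctau.
have T_ge0 i j : 0 <= T i j.
  have [->|/Ttau] := eqVneq i j; first by rewrite T0.
  by apply: le_trans; exact: ltW.
have cT' i j : T i j <= c.
  rewrite !le_max; apply/orP; right; apply/orP; right.
  rewrite (bigD1 i)//= (bigD1 j)//= -addrA ler_wpDr ?ler_norm//.
  by rewrite addr_ge0 ?sumr_ge0// => k _; rewrite sumr_ge0.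
pose y i j := T i j / c.
have y_ge0 i j : 0 <= y i j by rewrite divr_ge0// ltW.
have y_le1 i j : y i j <= 1 by rewrite ler_pdivrMr// mul1r.
have y_tau i j : i != j -> tau / c <= y i j.
  by move=> /Ttau h; rewrite ler_pM2r// invr_gt0.
have ps : psd (fun i j => 1 - y i j).
  split=> [i j|b]; first by rewrite /y sT.
  rewrite qfBl qf1.
  have -> : qf y b = c^-1 * qf T b.
    by rewrite -qfZl; apply: eq_qf => i j; rewrite mulrC.
  rewrite subr_ge0 mulrC ler_pdivrMr// mulrC (le_trans (Hc0 b))//.
  by rewrite ler_wpM2r// sqr_ge0.
(* For [k >= B], [k * (tau / c) >= 2 * n], so [bernoulli] gives [(1 - tau / c) ^+ k * n <= 2^-1]:
   the off-diagonal part of the [k]-th power costs at most half of [sqnorm a]. *)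
pose B := 2 * n * c / tau.
have B1 : 1 <= B by rewrite ler_pdivlMr// mul1r; nra.
pose M := (Num.truncn B).+1.
have BM : B <= M%:R by rewrite ltW// truncnS_gt.
have MB : M%:R <= 2 * B.
  have : (Num.truncn B)%:R <= B by rewrite truncn_le; lra.
  by rewrite /M -natr1; lra.
have off k : (M <= k)%N -> sqnorm a / 2 <= qf (fun i j => (1 - y i j) ^+ k) a.
  move=> Mk.
  pose o i j := if i == j then 0 else (1 - y i j) ^+ k.
  have -> : qf (fun i j => (1 - y i j) ^+ k) a = sqnorm a + qf o a.
    rewrite -qf_id -qfDl; apply: eq_qf => i j; rewrite /o.
    case: eqVneq => [->|_]; last by rewrite add0r.
    by rewrite /y T0 mul0r subr0 expr1n addr0.
  pose r := (1 - tau / c) ^+ k.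
  have x0 : 0 <= tau / c by rewrite divr_ge0 ?ltW.
  have x1 : tau / c <= 1 by rewrite ler_pdivrMr// mul1r.
  have ho i j : `|o i j| <= r.
    rewrite /o /r; case: eqVneq => [_|ij].
      by rewrite normr0 exprn_ge0// subr_ge0.
    rewrite ger0_norm ?exprn_ge0 ?subr_ge0//.
    by rewrite lerXn2r ?nnegrE ?subr_ge0// lerD2l lerN2 y_tau.
  have rn : r * n <= 2^-1.
    have Bx : B * (tau / c) = 2 * n by rewrite /B; field; rewrite !gt_eqF.
    have Bk : B <= k%:R by apply: le_trans BM _; rewrite ler_nat.
    have := ler_wpM2r x0 Bk; rewrite Bx => nk.
    have := bernoulli k x0 x1; rewrite -/r => rk.
    have r0 : 0 <= r by rewrite exprn_ge0// subr_ge0.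
    have := ler_wpM2l r0 nk; lra.
  have := qf_bound a ho; rewrite -/n ler_norml => /andP[+ _].
  have : r * n * sqnorm a <= 2^-1 * sqnorm a.
    by rewrite ler_wpM2r// sqnorm_ge0.
  lra.
pose G N i j := (binp al N).[y i j].
(* The constant term vanishes on the hyperplane and, by Schur, each further term only lowers the
   form. *)
have GM : qf (G M) a <= 0.
  elim: M {BM MB off} => [|N IH].
    rewrite (eq_qf (L := fun _ _ => 1)) ?qf1 ?a0 ?expr0n// => i j.
    by rewrite /G hornerC.
  rewrite (eq_qf (L := fun i j => G N i j - binc al N * (1 - y i j) ^+ N.+1)).
    rewrite qfBl qfZl subr_le0 (le_trans IH)// mulr_ge0 ?binc_ge0//.
    by case: (psd_exp N.+1 ps).
  by move=> i j; rewrite /G horner_binpS.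
(* Past [M] each term lowers the form by at least its coefficient times [sqnorm a / 2]; the
   coefficients telescope by [binqS]. *)
have GN N : qf (G (N + M)%N) a <= - (binq al M - binq al (N + M)%N) * (sqnorm a
  / 2).
  elim: N => [|N IH]; first by rewrite add0n subrr oppr0 mul0r.
  rewrite addSn (eq_qf (L := fun i j =>
    G (N + M)%N i j - binc al (N + M)%N * (1 - y i j) ^+ (N + M).+1)).
    rewrite qfBl qfZl binqS.
    have := off (N + M).+1 (leqW (leq_addl _ _)).
    move=> /(ler_wpM2l (binc_ge0 al0 al1 (N + M))); lra.
  by move=> i j; rewrite /G horner_binpS.
have lim : qf (fun i j => y i j `^ al) a <= - binq al M * (sqnorm a / 2).
  rewrite -[leLHS]subr0 -(mul0r (sqnorm a / 2)).
  have cG i j : G N i j @[N --> \oo] --> y i j `^ al.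
    (* At zero entries, such as the diagonal, the partial sums are [binq N]. *)
    have [y0|y0] := eqVneq (y i j) 0.
      rewrite y0 powR0 ?gt_eqF//.
      under eq_cvg do rewrite /G y0 binp0.
      exact: cvg_binq.
    by apply: cvg_binp; rewrite // lt_def y0 y_ge0 y_le1.
  have cl : qf (G N) a - binq al N * (sqnorm a / 2) @[N --> \oo] -->
      qf (fun i j => y i j `^ al) a - 0 * (sqnorm a / 2).
    apply: cvgB; first exact: cvg_qf.
    by apply: cvgM; [exact: cvg_binq|exact: cvg_cst].
  apply: (cvgr_to_le cl).
  exists M => // N /= MN.
  have := GN (N - M)%N; rewrite subnK//.
  rewrite /GRing.mul_fun /=; lra.
have -> : qf (fun i j => T i j `^ al) a = c `^ al * qf (fun i j => y i j `^ al)
  a.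
  rewrite -qfZl; apply: eq_qf => i j; rewrite -powRM ?(ltW c_gt0)//.
  by rewrite mulrC divfK// gt_eqF.
apply: le_trans (ler_wpM2l (powR_ge0 _ _) lim) _.
(* As M <= 4 n c / tau, [binq_lb] bounds [binq al M] below by (1 - al) (4 n c / tau)^(-al), and the
   factor c^al cancels [c]. *)
suff h : (1 - al) * (4 * n / tau) `^ (- al) <= c `^ al * binq al M.
  have := ler_wpM2r (sqnorm_ge0 a) h; lra.
have X0 : 0 < 4 * n / tau by rewrite divr_gt0// mulr_gt0//; lra.
rewrite powRN ler_pdivrMr ?powR_gt0//.
apply: le_trans (binq_lb al0 al1 (Num.truncn B)) _.
rewrite -/M -[leRHS]mulrA [leRHS]mulrCA.
have /andP[q0 _] := binq_itv al0 al1 M.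
rewrite ler_wpM2l// -powRM ?(ltW c_gt0) ?(ltW X0)//.
rewrite ge0_ler_powR ?nnegrE ?(ltW al0) ?(mulr_ge0 (ltW c_gt0) (ltW X0))//.
by apply: le_trans MB _; rewrite /B; lra.
Qed.

End ConditionallyNegative.

(** * Powers of conditionally negative matrices without margin *)

Section ConditionallyNegativeLimits.
Variables (R : realType) (I : finType).
Implicit Types (T : I -> I -> R) (a : I -> R).

Lemma cneg_le e f T : f <= e -> cneg e T -> cneg f T.
Proof.
move=> fe cT a a0; apply: le_trans (cT a a0) _.
by rewrite ler_wpM2r ?sqnorm_ge0// lerN2.
Qed.

(** The all-ones part vanishes on the hyperplane, so only [- t * sqnorm a] remains; the diagonal of
    [T] is unchanged. *)
Lemma cneg_perturb T e t : symf T -> cneg e T ->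
  cneg (e + t) (fun i j => T i j + t * (1 - (i == j)%:R)).
Proof.
move=> sT cT a a0; rewrite qfDl qfZl qfBl qf1 a0 expr0n/= sub0r qf_id.
by have := cT a a0; lra.
Qed.

Lemma cvg_powRl (al y : R) : 0 < y -> z `^ al @[z --> y] --> y `^ al.
Proof.
move=> y0; have [/derivable1_diffP/differentiable_continuous + _] :=
  is_derive1_powR al y0.
exact.
Qed.

Lemma cneg0_powR_strict T (al tau : R) : 0 < al < 1 -> 0 < tau -> (0 < #|I|)%N
  ->
  symf T -> (forall i, T i i = 0) -> (forall i j, i != j -> tau <= T i j) ->
  cneg 0 T -> exists2 k, 0 < k & cneg k (fun i j => T i j `^ al).
Proof.
move=> al01 tau0 I0 sT T0 Ttau cT; have /andP[al0 al1] := al01.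
exists ((1 - al) / 2 * (4 * #|I|%:R / tau) `^ (- al)).
  rewrite mulr_gt0 ?powR_gt0 ?divr_gt0 ?subr_gt0//.
  by rewrite mulr_gt0// ltr0n.
pose K (e : R) i j : R := T i j + e * (1 - (i == j)%:R).
apply: (@cneg_closed _ _ _ 0^'+ _ (fun e i j => K e i j `^ al)).
  move=> i j; apply: cvg_at_right_filter; rewrite /K.
  (* The diagonal stays zero for every [e], so continuity of the power is used only at positive
     entries. *)
  have [->|ij] := eqVneq i j.
    rewrite T0; apply: cvg_near_cst; apply: nearW => e.
    by rewrite subrr mulr0 addr0.
  have ce : T i j + e * (1 - false%:R) @[e --> (0 : R)] --> T i j.
    rewrite -[X in _ --> X]addr0 -[X in _ --> _ + X](mul0r (1 - false%:R)).
    by apply: cvgD; [exact: cvg_cst|apply: cvgM; [exact: cvg_id|exact: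
      cvg_cst]].
  have Tij : 0 < T i j by apply: lt_le_trans (Ttau _ _ ij).
  exact: (cvg_comp _ (@powR R ^~ al) ce (cvg_powRl Tij)).
near=> e; have e0 : 0 < e by [].
apply: (cneg_powR al01 tau0 e0).
- by move=> i j; rewrite /K sT eq_sym.
- by move=> i; rewrite /K T0 eqxx subrr mulr0 addr0.
- by move=> i j ij; rewrite /K (negPf ij) subr0 mulr1 ler_wpDr ?Ttau// ltW.
- by have := cneg_perturb e sT cT; rewrite add0r.
Unshelve. all: end_near. Qed.

End ConditionallyNegativeLimits.

(** * Strict conditional negativity and the inverse matrix *)

Section Hollow.
Variables (R : realType) (n : nat) (D : 'M[R]_n).
Let T i j := D i j.
Hypotheses (n2 : (2 <= n)%N) (sT : symf T).

Lemma cneg_eq0 e a : 0 < e -> cneg e T -> \sum_i a i = 0 -> 0 <= qf T a ->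
  forall i, a i = 0.
Proof.
move=> e0 cT a0 qa i.
have S0 : sqnorm a <= 0.
  by have := cT a a0 => h; rewrite -(pmulr_rle0 _ e0); lra.
have : sqnorm a == 0 by rewrite eq_le S0 sqnorm_ge0.
rewrite psumr_eq0; last by move=> ? _; exact: sqr_ge0.
by move=> /allP/(_ i (mem_index_enum _)); rewrite sqrf_eq0 => /eqP.
Qed.

(** A kernel vector [a] with zero sum vanishes by strictness. Otherwise the constant vector 1 and
    its zero-sum modification [u] by [a] have the same form value, nonpositive for [u] but positive
    for 1. *)
Lemma cneg_det e : 0 < e -> cneg e T ->
  (forall i, T i i = 0) -> (forall i j, i != j -> 0 < T i j) -> \det D != 0.
Proof.
move=> e0 cT T0 Tpos; apply/negP => /det0P[v v0 vD].
pose a i := v 0 i; pose s := \sum_i a i.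
have bfa b : bf T a b = 0.
  rewrite /bf exchange_big big1// => j _ /=.
  rewrite -mulr_suml; have /rowP/(_ j) := vD; rewrite !mxE => h.
  rewrite (_ : \sum_i _ = 0) ?mul0r// -[RHS]h; apply: eq_bigr => i _.
  by rewrite mulrC.
have [s0|s0] := eqVneq s 0.
  move/eqP: v0; apply; apply/rowP => i; rewrite mxE.
  by apply: (cneg_eq0 (a := a) e0 cT) => //; rewrite /qf bfa.
pose u i := 1 - n%:R / s * a i.
have u0 : \sum_i u i = 0.
  rewrite big_split/= sumrN -mulr_sumr -/s divfK// sumr_const card_ord.
  by rewrite subrr.
have q1 : qf T (fun=> 1) <= 0.
  have -> : qf T (fun=> 1) = qf T (fun i => u i + n%:R / s * a i).
    by congr qf; apply/funext => i; rewrite subrK.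
  rewrite qf_line// (bfC _ _ sT) bfa /qf bfa !mulr0 mul0rn !addr0.
  apply: le_trans (cT u u0) _; rewrite mulNr oppr_le0.
  by rewrite mulr_ge0 ?sqnorm_ge0// ltW.
have Tge0 i j : 0 <= T i j.
  by have [->|/Tpos/ltW//] := eqVneq i j; rewrite T0.
pose i0 : 'I_n := Ordinal (ltnW n2); pose i1 : 'I_n := Ordinal n2.
have : T i0 i1 <= qf T (fun=> 1).
  rewrite /qf /bf (bigD1 i0)//= (bigD1 i1)//= !mulr1 -addrA lerDl addr_ge0//.
    by apply: sumr_ge0 => i _; rewrite !mulr1.
  by do 2! (apply: sumr_ge0 => ? _); rewrite !mulr1.
by have := Tpos i0 i1 isT; lra.
Qed.

(** If [a] = D^-1 1 had zero sum, then [qf T a], which equals that sum, would vanish; strictness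
    would give [a] = 0, against D a = 1. *)
Lemma cneg_dot e : 0 < e -> cneg e T -> D \in unitmx ->
  dotcv (invmx D *m const_mx 1) (const_mx 1) != 0.
Proof.
move=> e0 cT uD; apply/negP => /eqP.
set v := invmx D *m _; rewrite /dotcv => v0.
pose a i := v i 0.
have a0 : \sum_i a i = 0.
  by rewrite -[RHS]v0; apply: eq_bigr => i _; rewrite [const_mx _ _ _]mxE mulr1.
have Dv : D *m v = const_mx 1 by rewrite mulKVmx.
have az : forall i, a i = 0.
  apply: (cneg_eq0 e0 cT a0); rewrite /qf /bf.
  rewrite (eq_bigr a) ?a0// => i _.
  have /colP/(_ i) := Dv; rewrite !mxE => h.
  rewrite -[RHS]mulr1 -h mulr_sumr; apply: eq_bigr => j _.
  by rewrite /T mulrCA mulrA.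
have /colP/(_ (Ordinal (ltnW n2))) := Dv; rewrite !mxE big1.
  by move/esym/eqP; rewrite oner_eq0.
by move=> i _; rewrite [v i 0]az mulr0.
Qed.

(* The vectors [y i] are the columns of the inverse of the bordered matrix: they
   have zero sum, and [D *m y i] is the [i]-th unit vector plus a constant, so
   that Cauchy-Schwarz for [- D] bounds each coordinate of [a]. *)
Lemma cneg_coercive : cneg 0 T -> D \in unitmx ->
  dotcv (invmx D *m const_mx 1) (const_mx 1) != 0 ->
  exists2 e, 0 < e & cneg e T.
Proof.
move=> cT uD; set B := invmx D.
pose z k := \sum_l B k l; pose beta i := \sum_k B k i.
have -> : dotcv (B *m const_mx 1) (const_mx 1) = \sum_k z k.
  apply: eq_bigr => k _; rewrite !mxE mulr1; apply: eq_bigr => l _.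
  by rewrite mxE mulr1.
set w := \sum_k z k => w0.
pose y i k := B k i - beta i / w * z k.
have y0 i : \sum_k y i k = 0.
  by rewrite big_split/= sumrN -mulr_sumr divfK// subrr.
have DB j i : \sum_k D j k * B k i = (j == i)%:R.
  by have /matrixP/(_ j i) := mulmxV uD; rewrite !mxE.
have Dy i j : \sum_k T j k * y i k = (j == i)%:R - beta i / w.
  rewrite -DB -[beta i / w]mulr1.
  have -> : 1 = \sum_k D j k * z k.
    under eq_bigr do rewrite mulr_sumr.
    rewrite exchange_big /=; under eq_bigr do rewrite DB.
    by rewrite (bigD1 j)//= eqxx big1 ?addr0// => l; rewrite eq_sym => /negPf->.
  rewrite mulr_sumr -sumrB; apply: eq_bigr => k _.
  by rewrite /T /y; ring.
have bfy i a : \sum_k a k = 0 -> bf T (y i) a = a i.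
  move=> a0; rewrite bfC// /bf.
  have -> : \sum_j \sum_k T j k * a j * y i k =
      \sum_j ((j == i)%:R * a j - beta i / w * a j).
    apply: eq_bigr => j _; rewrite -mulrBl -Dy mulr_suml.
    by apply: eq_bigr => k _; rewrite mulrAC.
  rewrite sumrB -mulr_sumr a0 mulr0 subr0 (bigD1 i)//= eqxx mul1r big1 ?addr0//.
  by move=> j /negPf ->; rewrite mul0r.
have cT' a : \sum_i a i = 0 -> 0 <= - qf T a.
  by move=> /cT; rewrite oppr0 mul0r oppr_ge0.
(* Cauchy-Schwarz summed over [i] gives [sqnorm a <= (C - 1) * - qf T a]; the added 1 ensures
   [0 < C]. *)
pose C := 1 + \sum_i - qf T (y i).
have C0 : 0 < C.
  by rewrite ltr_pwDl// sumr_ge0// => i _; exact: cT'.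
exists C^-1; first by rewrite invr_gt0.
move=> a a0; rewrite mulNr lerNr mulrC ler_pdivrMr//.
have h : sqnorm a <= \sum_i - qf T (y i) * - qf T a.
  apply: ler_sum => i _; rewrite -{1}(bfy i a a0) -sqrrN.
  apply: discriminant_le; rewrite ?cT'// => t.
  have := cT' (fun k => y i k + t * a k); rewrite qf_line//.
  rewrite big_split/= -mulr_sumr y0 a0 mulr0 addr0 => /(_ erefl).
  lra.
apply: (le_trans h); rewrite -mulr_suml mulrC ler_wpM2l ?cT'//.
by rewrite /C lerDr.
Qed.

End Hollow.

(** * Distance matrices of a finite metric space as the exponent varies *)

Section MetricSpace.
Variables (R : realType) (X : metricType R).

Lemma distpow_gt0 p (u v : X) : u != v -> 0 < distpow p u v.
Proof.
by move=> uv; rewrite /distpow (negPf uv) powR_gt0// mdist_gt0.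
Qed.

Lemma distpowC p (u v : X) : distpow p u v = distpow p v u.
Proof. by rewrite /distpow eq_sym metric_sym. Qed.

Lemma distpow_powR p r (u v : X) : r != 0 ->
  distpow (p * r) u v = distpow p u v `^ r.
Proof.
by move=> r0; rewrite /distpow powRrM; case: eqP => // _; rewrite powR0.
Qed.

Lemma cvg_distpow p (u v : X) : distpow q u v @[q --> p] --> distpow p u v.
Proof.
rewrite /distpow; case: eqVneq => uv; first exact: cvg_cst.
have d0 : mdist u v != 0 by rewrite gt_eqF// mdist_gt0.
rewrite /powR (negPf d0).
apply: continuous_cvg; first exact: continuous_expR.
by apply: cvgM; [exact: cvg_id|exact: cvg_cst].
Qed.

Variables (n : nat) (x : 'I_n -> X).
Hypotheses (n2 : (2 <= n)%N) (x_bij : bijective x).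
Let T (p : R) i j := distpow p (x i) (x j).

(** Weights on any finite family of points are transported to the labelling [x] by summing over
    fibres. *)
Lemma negative_typeP p : negative_type X p <-> cneg 0 (T p).
Proof.
split=> [nt a a0|cT k y a _ _ a0].
  by rewrite oppr0 mul0r; exact: nt n2 (bij_inj x_bij) a0.
have [g xK gK] := x_bij.
pose s l := g (y l).
pose b i := \sum_(l | s l == i) a l.
have b0 : \sum_i b i = 0 by rewrite -[RHS]a0 [RHS](partition_big s xpredT).
have := cT b b0; rewrite oppr0 mul0r; congr (_ <= _).
rewrite [RHS](partition_big s xpredT)//=; apply: eq_bigr => i _.
under [RHS]eq_bigr do rewrite (partition_big s xpredT)//=.
rewrite exchange_big; apply: eq_bigr => j _ /=.
rewrite -mulrA big_distrlr mulr_sumr; apply: eq_bigr => l /eqP <-.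
rewrite mulr_sumr; apply: eq_bigr => m /eqP <-.
by rewrite /T /s !gK mulrA.
Qed.

Lemma T_sym p : symf (T p).
Proof. by move=> i j; rewrite /T distpowC. Qed.

Lemma T_diag p i : T p i i = 0.
Proof. by rewrite /T /distpow eqxx. Qed.

Lemma T_gt0 p i j : i != j -> 0 < T p i j.
Proof. by move=> ij; rewrite distpow_gt0// (inj_eq (bij_inj x_bij)). Qed.

(** Under the zero-diagonal convention [T 0] is the all-ones matrix minus the identity. *)
Lemma cneg_T0 : cneg 1 (T 0).
Proof.
move=> a a0.
rewrite (eq_qf (L := fun i j => 1 - (i == j)%:R)).
  by rewrite qfBl qf1 a0 expr0n sub0r qf_id mulN1r.
move=> i j; rewrite /T /distpow (inj_eq (bij_inj x_bij)) powRr0.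
by case: eqVneq; rewrite ?subrr ?subr0.
Qed.

(** Entrywise, [T q] is the power [q / p] of [T p]. The power lemma needs a positive exponent, so
    [q = 0] is settled by [cneg_T0]. *)
Lemma cneg_T_lt p q : 0 <= q -> q < p -> cneg 0 (T p) ->
  exists2 e, 0 < e & cneg e (T q).
Proof.
rewrite le_eqVlt => /predU1P[<- _ _|q0 qp cT].
  by exists 1 => //; exact: cneg_T0.
have p0 : 0 < p by apply: lt_trans qp.
have qp0 : 0 < q / p by rewrite divr_gt0.
pose tau := \big[Num.min/1]_(ij : 'I_n * 'I_n | ij.1 != ij.2) T p ij.1 ij.2.
have -> : T q = fun i j => T p i j `^ (q / p).
  apply/funext => i; apply/funext => j; rewrite /T -distpow_powR ?gt_eqF//.
  by rewrite mulrC divfK ?gt_eqF.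
apply: (@cneg0_powR_strict _ _ _ _ tau) => //.
- by rewrite qp0 ltr_pdivrMr// mul1r.
- by apply: lt_bigmin => //= -[i j] /=; exact: T_gt0.
- by rewrite card_ord ltnW.
- exact: T_sym.
- exact: T_diag.
- by move=> i j ij; exact: (bigmin_le_cond _ _ (j := (i, j))).
Qed.

(** Moving every entry by at most [e / n] changes the form by at most [e * sqnorm a], which the
    margin absorbs. *)
Lemma cneg_T_gt p e : 0 < e -> cneg e (T p) -> exists2 q, p < q & cneg 0 (T q).
Proof.
move=> e0 cT; have nr0 : (0 : R) < n%:R by rewrite ltr0n ltnW.
have near_e : \forall q \near p^'+, forall i j, `|T q i j - T p i j| <= e /
  n%:R.
  apply: filter_forall => i; apply: filter_forall => j.
  have /cvgrPdist_le/(_ (e / n%:R)) := cvg_at_right_filter (@cvg_distpow p (x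
    i) (x j)).
  rewrite divr_gt0// => /(_ isT); apply: filterS => q.
  by rewrite distrC.
have [q [pq hq]] := @filter_ex _ _ _ _ (filterI (nbhs_right_gt p) near_e).
exists q => // a a0.
have := qf_bound a hq; rewrite card_ord divfK ?gt_eqF// qfBl => /ler_normlW.
by have := cT a a0; lra.
Qed.

End MetricSpace.

(** * The supremal exponent as a minimum *)

Theorem corollary2p4 (R : realType) (X : metricType R) (n : nat)
    (x : 'I_n -> X) (n_ge2 : (2 <= n)%N) (x_bij : bijective x) :
  is_min
    [set p : R | 0 <= p /\
       (\det (distmx x p) = 0 \/
        (distmx x p \in unitmx /\
         dotcv (invmx (distmx x p) *m const_mx 1) (const_mx 1) = 0))]
    (supremal_negative_type X).
Proof.
pose T p i j := distpow p (x i) (x j).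
have TE p : (fun i j => distmx x p i j) = T p.
  by apply/funext => i; apply/funext => j; rewrite mxE.
set S := [set p : R | _]; set N := [set p : R | 0 <= p /\ negative_type X p].
have NP p : N p <-> 0 <= p /\ cneg 0 (T p).
  by split=> -[p0 /(negative_typeP n_ge2 x_bij p)].
have S_strict p e : 0 < e -> cneg e (T p) -> ~ S p.
  rewrite -TE => e0 cT [_ Sp].
  have sT : symf (fun i j => distmx x p i j) by rewrite TE; exact: T_sym.
  have /eqP dD : \det (distmx x p) != 0.
    apply: (cneg_det n_ge2 sT e0 cT) => [i|i j ij].
      by rewrite mxE /distpow eqxx.
    by rewrite mxE distpow_gt0// (inj_eq (bij_inj x_bij)).
  by case: Sp => // -[uD /eqP]; apply/negP; exact: cneg_dot cT uD.
have S_ge p q : N p -> S q -> p <= q.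
  move=> /NP[p0 cT] Sq; rewrite leNgt; apply/negP => qp.
  have [e e0 ce] := cneg_T_lt n_ge2 x_bij (proj1 Sq) qp cT.
  exact: S_strict ce Sq.
have N0 : N 0 by apply/NP; split => //; apply: cneg_le (cneg_T0 x_bij).
have ubN p : N p -> (p%:E <= supremal_negative_type X)%E.
  by move=> Np; apply: ereal_sup_ubound; exists p.
have supN (q : R) : (q%:E < supremal_negative_type X)%E -> exists2 p, N p & q <
  p.
  by move=> /ereal_sup_gt[_ [p Np <-]]; rewrite lte_fin; exists p.
case E : (supremal_negative_type X) => [p| |]; last first.
- by have := ubN 0 N0; rewrite E.
(* Each [q] in [S] bounds [N] from above, so an infinite supremum leaves [S] empty. *)
- left; split => //; apply/seteqP; split => // q Sq.
  have [|p Np] := supN q; first by rewrite E ltry.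
  by rewrite ltNge S_ge.
right; exists p; split => //; last first.
  move=> q Sq; rewrite leNgt; apply/negP => qp.
  have [|r Nr] := supN q; first by rewrite E lte_fin.
  by rewrite ltNge S_ge.
have p_ub q : N q -> q <= p by move=> /ubN; rewrite E lee_fin.
have p0 : 0 <= p by exact: p_ub.
(* The supremum is attained, since negative type is a closed condition on the exponent. *)
have cTp : cneg 0 (T p).
  have [Np|Np] := pselect (N p); first by case/NP: Np.
  apply: (@cneg_closed _ _ _ p^'- _ T).
    by move=> i j; apply: cvg_at_left_filter; exact: cvg_distpow.
  (* [N 0] rules out [p = 0], so exponents just below [p] can be taken nonnegative. *)
  have p_gt0 : 0 < p.
    by rewrite lt_def p0 andbT; apply/eqP => pE; apply: Np; rewrite pE.
  near=> q.
  have [|r /NP[r0 cTr] qr] := supN q; first by rewrite E lte_fin.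
  have [|e e0 ce] := cneg_T_lt n_ge2 x_bij _ qr cTr.
    by near: q; apply: filterS (nbhs_left_gt p_gt0) => q /ltW.
  by apply: cneg_le ce; exact: ltW.
(* Outside [S], negative type at [p] would have a margin and extend to some [q > p], against the
   supremum. *)
split => //; apply: contrapT => /not_orP[/eqP dD nS].
have uD : distmx x p \in unitmx by rewrite unitmxE unitfE.
have /eqP wD : dotcv (invmx (distmx x p) *m const_mx 1) (const_mx 1) <> 0.
  by move=> w0; apply: nS.
have sT : symf (fun i j => distmx x p i j) by rewrite TE; exact: T_sym.
have [|e e0] := cneg_coercive sT _ uD wD; first by rewrite TE.
rewrite TE => /(cneg_T_gt n_ge2 e0)[q pq cTq].
have : N q by apply/NP; split => //; apply: le_trans (ltW pq).
by move/p_ub; rewrite leNgt pq.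
Unshelve. all: end_near. Qed.
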